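(* Let $\mathbb{F}$ be a field of characteristic different from $2$ with $q$ elements ($q$ finite), and let $G=\mathbb{Z}_2\times\mathbb{Z}_2$. Let $E=M_2(\mathbb{F})$ with the $G$-grading $$E_{(0,0)}=\mathbb{F}I_2,\quad E_{(1,0)}=\mathbb{F}X,\quad E_{(0,1)}=\mathbb{F}Y,\quad E_{(1,1)}=\mathbb{F}XY,$$ where $X,Y\in M_2(\mathbb{F})$ are invertible matrices such that $X^2,Y^2\in\mathbb{F}I_2$ and $XY=-YX$. Then the ideal $Id_G(E)$ of $G$-graded polynomial identities of $E$ is generated, as a $T_G$-ideal, by the polynomials $$x_{1,g}^{q}-s_g x_{1,g}\quad (g\in G)\qquad\text{and}\qquad x_{1,g}x_{2,h}-\beta(g,h)\,x_{2,h}x_{1,g}\quad (g,h\in G),$$ where $s_g\in\{1,-1\}$ and $\beta$ are as defined in the context. Moreover, if $\le$ is a total order on the set $X_G$ of indeterminates, then a basis, as a vector space, of the relatively free algebra $\mathbb{F}\langle X_G\rangle/Id_G(E)$ consists of the images of the monomials $m=x_{i_1,g_{i_1}}\cdots x_{i_m,g_{i_m}}$ with $x_{i_1,g_{i_1}}\le\cdots\le x_{i_m,g_{i_m}}$ and $0\le\deg_{x_{i,g}}m<q$ for all $i\ge 1$ and all $g\in G$.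
   Context: Algebras are associative and not necessarily unital. For a group $G$, a $G$-graded $\mathbb{F}$-algebra is an algebra $A=\bigoplus_{g\in G}A_g$ (direct sum of subspaces) with $A_gA_h\subseteq A_{gh}$. $\mathbb{F}\langle X_G\rangle$ is the free $G$-graded associative algebra (without unit, so monomials are nonempty) on $X_G$, the disjoint union of the countable sets $X_g=\{x_{i,g}\mid i\ge 1\}$, $g\in G$, where $x_{i,g}$ has degree $g$. A polynomial $f(x_{1,g_1},\dots,x_{n,g_n})$ is a graded polynomial identity of $A$ if $f(a_1,\dots,a_n)=0$ for all $a_i\in A_{g_i}$. The set $Id_G(A)$ of graded identities of $A$ is a $T_G$-ideal, i.e. a two-sided ideal invariant under all graded endomorphisms of $\mathbb{F}\langle X_G\rangle$. The $T_G$-ideal generated by a set $S$ is the smallest $T_G$-ideal containing $S$. For each $g\in G$, $s_g\in\{1,-1\}$ denotes the sign for which $x_{1,g}^{q}-s_gx_{1,g}$ is a graded polynomial identity of $E$; explicitly, for any nonzero $P\in E_g$ one has $P^2=\omega_P I_2$ with $\omega_P\in\mathbb{F}^{\times}$, and $s_g=\omega_P^{(q-1)/2}$. The map $\beta:G\times G\to\mathbb{F}^{\times}$ is the alternating bicharacter with $\beta(a,b)=-1$, where $a=(1,0)$, $b=(0,1)$ (a bicharacter is multiplicative in each argument; alternating means $\beta(g,g)=1$ for all $g$). $\deg_{x}m$ is the number of occurrences of the indeterminate $x$ in the monomial $m$. *)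

(* Defs.v *)
From HB Require Import structures.
From mathcomp Require Import all_boot all_order all_algebra all_field.
From mathcomp Require Import finmap.
From mathcomp.multinomials Require Export monalg.

Set Implicit Arguments.
Unset Strict Implicit.
Unset Printing Implicit Defensive.

Import GRing.Theory.
Local Open Scope ring_scope.

(* The grading group is written additively (only abelian groups are needed).
   The indeterminate x_{i,g}, i >= 1, is the pair (i.-1, g). *)
Notation gvar G := (nat * G)%type.
Notation gmon G := {fmonom (gvar G)}.

(* Unital free algebra on the indeterminates x_{i,g}.  The algebra F<X_G>
   without unit is its augmentation ideal, singled out by [in_free]. *)
Notation ufree F G := {malg F[gmon G]}.

Section FreeGradedAlgebra.
Variables (F : fieldType) (G : zmodType).
Implicit Types (f h u : ufree F G) (g : G).

Definition in_free f : Prop := f@_(mone) = 0.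

Definition gX (i : nat) g : ufree F G := << fmu (i.-1, g) >>.

Definition mon_deg (m : gmon G) : G := \sum_(x <- (m : seq (gvar G))) x.2.

Definition in_free_deg g f : Prop :=
  in_free f /\ {in msupp f, forall m, mon_deg m = g}.

(* A graded endomorphism of F<X_G>; the values of phi outside F<X_G> are
   irrelevant. *)
Definition graded_endo (phi : ufree F G -> ufree F G) : Prop :=
  [/\ forall f, in_free f -> in_free (phi f),
      forall (c : F) f h, in_free f -> in_free h ->
        phi (c *: f + h) = c *: phi f + phi h,
      forall f h, in_free f -> in_free h -> phi (f * h) = phi f * phi h
    & forall g f, in_free_deg g f -> in_free_deg g (phi f)].

Record TG_ideal (I : ufree F G -> Prop) : Prop := TGIdeal {
  TG_free : forall f, I f -> in_free f;
  TG_0 : I 0;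
  TG_lin : forall (c : F) f h, I f -> I h -> I (c *: f + h);
  TG_mull : forall u f, in_free u -> I f -> I (u * f);
  TG_mulr : forall u f, in_free u -> I f -> I (f * u);
  TG_endo : forall phi, graded_endo phi -> forall f, I f -> I (phi f)
}.

(* Meant for S contained in F<X_G>. *)
Definition TG_generated (S : ufree F G -> Prop) f : Prop :=
  forall I : ufree F G -> Prop, TG_ideal I -> (forall h, S h -> I h) -> I f.

Section Identities.
Variables (A : algType F) (gr : G -> {pred A}).

Definition geval (rho : gvar G -> A) f : A :=
  mmap (in_alg A)
       (fun m : gmon G => \prod_(x <- (m : seq (gvar G))) rho x) f.

Definition graded_identity f : Prop :=
  in_free f /\
  forall rho : gvar G -> A, (forall x, rho x \in gr x.2) -> geval rho f = 0.

End Identities.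
End FreeGradedAlgebra.

(* The classes modulo W of the b j, for j in D, form a basis (as a family) of
   the quotient space U / W, where W <= U are subspaces of V. *)
Definition quotient_basis (F : fieldType) (V : lmodType F) (U W : V -> Prop)
    (J : eqType) (D : {pred J}) (b : J -> V) : Prop :=
  [/\ forall j, j \in D -> U (b j),
      forall v, U v -> exists (s : seq J) (c : J -> F),
        {subset s <= D} /\ W (v - \sum_(j <- s) c j *: b j)
    & forall (s : seq J) (c : J -> F), uniq s -> {subset s <= D} ->
        W (\sum_(j <- s) c j *: b j) -> {in s, forall j, c j = 0}].

Definition ordered_mon (G : zmodType) (le : rel (gvar G)) (q : nat) :
    {pred gmon G} :=
  [pred m : gmon G | [&& m != mone, sorted le m
     & all (fun x => count_mem x m < q)%N m]].

Notation Z22 := ('Z_2 * 'Z_2)%type.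

Record alternating_bicharacter (F : fieldType) (G : zmodType)
    (beta : G -> G -> F) : Prop := AltBichar {
  bichar_neq0 : forall g h, beta g h != 0;
  bichar_Dl : forall g g' h, beta (g + g') h = beta g h * beta g' h;
  bichar_Dr : forall g h h', beta g (h + h') = beta g h * beta g h';
  bichar_alt : forall g, beta g g = 1
}.

Section Pauli.
Variables (F : finFieldType) (X Y : 'M[F]_2).

(* The matrices I, X, Y, XY in degrees (0,0), (1,0), (0,1), (1,1). *)
Definition pauli (g : Z22) : 'M[F]_2 := X ^+ (g.1 : nat) * Y ^+ (g.2 : nat).

Definition pauli_gr (g : Z22) : {pred 'M[F]_2} := mem <[pauli g]>%VS.

(* s_g computed on P = pauli g, whose square is the scalar matrix omega_P I;
   see [pauli_sgnP] for the independence of P. *)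
Definition pauli_sgn (g : Z22) : F :=
  ((pauli g * pauli g) 0 0) ^+ (#|F|.-1)./2.

Definition pauli_gens (beta : Z22 -> Z22 -> F) (f : ufree F Z22) : Prop :=
  (exists g, f = gX F 1 g ^+ #|F| - pauli_sgn g *: gX F 1 g) \/
  (exists g h, f = gX F 1 g * gX F 2 h - beta g h *: (gX F 2 h * gX F 1 g)).

Section Facts.
Hypothesis char_neq2 : 2%N \notin [pchar F].
Hypotheses (X_unit : X \in unitmx) (Y_unit : Y \in unitmx).
Hypotheses (X2_scalar : is_scalar_mx (X * X)) (Y2_scalar : is_scalar_mx (Y * Y)).
Hypothesis XY_anticomm : X * Y = - (Y * X).

Let Z2P (i : 'Z_2) : i = 0 \/ i = 1.
Proof. by case: i => [[|[|//]] ?]; [left|right]; apply: val_inj. Qed.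

Let pauli_unit g : pauli g \is a GRing.unit.
Proof. by rewrite unitrMl unitrX. Qed.

Lemma pauli_neq0 g : pauli g != 0.
Proof. by apply: contraTneq (pauli_unit g) => ->; rewrite unitr0. Qed.

Lemma pauliM g h : exists2 c, c != 0 & pauli g * pauli h = c *: pauli (g + h).
Proof.
have [a Ea] := is_scalar_mxP X2_scalar; have [b Eb] := is_scalar_mxP Y2_scalar.
have XX : X * X = a *: 1 by rewrite Ea scalemx1.
have YY : Y * Y = b *: 1 by rewrite Eb scalemx1.
have YX : Y * X = - (X * Y) by rewrite XY_anticomm opprK.
have XXm Z : X * (X * Z) = a *: Z by rewrite mulrA XX -scalerAl mul1r.
have YYm Z : Y * (Y * Z) = b *: Z by rewrite mulrA YY -scalerAl mul1r.
have YXm Z : Y * (X * Z) = - (X * (Y * Z)) by rewrite mulrA YX mulNr mulrA.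
suff [c Ec] : exists c, pauli g * pauli h = c *: pauli (g + h).
  exists c => //; have : pauli g * pauli h \is a GRing.unit by rewrite unitrMl.
  by apply: contraTneq => c0; rewrite Ec c0 scale0r unitr0.
have Z11 : (1 + 1 : 'Z_2) = 0 by exact: val_inj.
case: g h => [i j] [k l]; rewrite /pauli.
have -> : (i, j) + (k, l) = (i + k, j + l) :> Z22 by [].
case: (Z2P i) (Z2P j) (Z2P k) (Z2P l) => -> [] -> [] -> [] ->;
  rewrite ?addr0 ?add0r ?Z11 /= ?expr0 ?expr1 ?mul1r ?mulr1 -?mulrA;
  rewrite ?(XXm, YYm, YXm, XX, YY, YX, mulrN, mulNr, opprK, mulr1, mul1r);
  rewrite -?scalerAr ?(XXm, YYm, XX, YY) ?mulr1 ?scalerA -?scaleNr;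
  by [exists 1; rewrite scale1r | eexists; reflexivity
     | exists (-1); rewrite scaleN1r].
Qed.

Let neq2 : 2%:R != 0 :> F.
Proof. by apply: contra char_neq2 => e; rewrite inE. Qed.

Let Z22D (g : Z22) : g + g = 0.
Proof.
case: g => i j; have D (k : 'Z_2) : k + k = 0.
  by case: (Z2P k) => ->; rewrite ?addr0 //; apply: val_inj.
by have -> : (i, j) + (i, j) = (i + i, j + j) :> Z22 by []; rewrite !D.
Qed.

Let pauli_sqr g : exists2 w, w != 0 & pauli g * pauli g = w%:M.
Proof.
have [w w0 Ew] := pauliM g g; exists w => //.
by rewrite Ew Z22D /pauli /= !expr0 mulr1 scalemx1.
Qed.

Let mxtrace_pauli g : g != 0 -> \tr (pauli g) = 0.
Proof.
move=> g0; have [Q Qu PQ] : exists2 Q, Q \is a GRing.unit &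
    pauli g * Q = - (Q * pauli g).
  case: g g0 => i j; case: (Z2P i) (Z2P j) => -> [] -> // _; rewrite /pauli /=.
  - exists X => //; rewrite !expr0 expr1 !mul1r.
    by rewrite XY_anticomm opprK.
  - by exists Y => //; rewrite !expr0 expr1 mulr1.
  - exists X => //; rewrite !expr1.
    by rewrite -[LHS]mulrA [in RHS]XY_anticomm mulrN opprK.
have E : \tr (pauli g) = - \tr (pauli g).
  have {1}-> : pauli g = - (Q * pauli g / Q) by rewrite -mulNr -PQ mulrK.
  by rewrite raddfN /= mxtrace_mulC -[_ *m _]/(_ * _) mulKr.
apply/eqP; have /eqP : \tr (pauli g) *+ 2 = 0 by rewrite mulr2n {1}E addNr.
by rewrite -mulr_natl mulf_eq0 (negPf neq2).
Qed.

Lemma pauli_grading :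
  [/\ directv (\sum_g <[pauli g]>), (\sum_g <[pauli g]> = fullv)%VS
    & forall g h, (<[pauli g]> * <[pauli h]> <= <[pauli (g + h)%R]>)%VS].
Proof.
have dir : directv (\sum_g <[pauli g]>).
  apply/directv_sum_independent => u Hu sum0 g _.
  have /fin_all_exists [c Ec] h : exists c, u h = c *: pauli h.
    by have /vlineP[c ->] := Hu h isT; exists c.
  rewrite Ec; suff -> : c g = 0 by rewrite scale0r.
  have /(congr1 mxtrace) : pauli g * (\sum_h u h) = 0 by rewrite sum0 mulr0.
  rewrite mulr_sumr raddf_sum /= (bigD1 g) //= big1 => [|h hg].
    have [w w0 Ew] := pauli_sqr g.
    rewrite raddf0 addr0 Ec -scalerAr Ew mxtraceZ mxtrace_scalar -mulr_natr.
    move/eqP; rewrite !mulf_eq0 (negPf w0) (negPf neq2) !orbF.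
    by move/eqP.
  have [w w0 Ew] := pauliM g h.
  rewrite Ec -scalerAr Ew !mxtraceZ mxtrace_pauli ?mulr0 //.
  apply: contraNneq hg => e.
  by rewrite -(addr0 h) -(Z22D g) addrA [h + g]addrC e add0r.
split=> // [|g h]; last first.
  have [w w0 Ew] := pauliM g h.
  by rewrite prodv_line Ew -memvE memvZ ?memv_line.
apply/eqP; rewrite eqEdim subvf (directvP dir) /= dimvf.
rewrite (eq_bigr (fun=> 1%N)) => [|g _]; last by rewrite dim_vline pauli_neq0.
by rewrite sum1_card card_prod !card_ord.
Qed.

Let half_card (c : F) : c != 0 -> (c ^+ (#|F|.-1)./2) ^+ 2 = 1.
Proof.
move=> c0; have q0 : (0 < #|F|)%N by apply/card_gt0P; exists 0.
have q_odd : odd #|F|.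
  apply: contraNT neq2 => e; have := expf_card (-1 : F).
  by rewrite -signr_odd (negPf e) expr0 => /eqP; rewrite -addr_eq0.
have q1 : ~~ odd #|F|.-1 by case: #|F| q0 q_odd.
apply: (mulfI c0).
by rewrite -exprM muln2 even_halfK // -exprS prednK // expf_card mulr1.
Qed.

(* pauli_sgn g does not depend on the choice of a nonzero P of degree g. *)
Lemma pauli_sgnP g (P : 'M[F]_2) : P \in pauli_gr g -> P != 0 ->
  exists w, [/\ w != 0, P * P = w%:M & pauli_sgn g = w ^+ (#|F|.-1)./2].
Proof.
move=> /vlineP[c ->] cP0; have [w w0 Ew] := pauli_sqr g.
have c0 : c != 0 by apply: contraNneq cP0 => ->; rewrite scale0r.
exists (c ^+ 2 * w); split; first by rewrite mulf_neq0 ?expf_neq0.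
  by rewrite -scalerAl -scalerAr Ew scalerA scale_scalar_mx expr2.
by rewrite /pauli_sgn Ew mxE eqxx exprMn exprAC half_card // mul1r.
Qed.

Lemma pauli_sgn_sign g : pauli_sgn g = 1 \/ pauli_sgn g = -1.
Proof.
have [w w0 Ew] := pauli_sqr g.
have /eqP := half_card w0; rewrite sqrf_eq1 => /orP sgn_w.
by rewrite /pauli_sgn Ew mxE eqxx; case: sgn_w => /eqP; [left | right].
Qed.

End Facts.

End Pauli.

(* Main.v *)
(* Modulo the generators every word is proportional to an ordered word in which
   each letter occurs fewer than q times: the commutation relations sort the
   letters, and x^q = s_g x shortens a word with too many repetitions.
   Conversely, put x_{i,g} = a_{i,g} P_g with P_g = pauli g and free scalars a.
   A word takes an invertible value, independent of a, times the commutative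
   monomial in the a_{i,g} given by its letter counts, and an ordered word is
   determined by these counts.  A polynomial of degree < q in each variable,
   here with coefficients in M_2(F), which vanishes on all of F^n is zero, so no
   nontrivial combination of the ordered words is an identity. *)

Require Import Defs.
From HB Require Import structures.
From mathcomp Require Import all_boot all_order all_algebra all_field.
From mathcomp Require Import finmap.
From mathcomp.multinomials Require Import monalg.

Set Implicit Arguments.
Unset Strict Implicit.
Unset Printing Implicit Defensive.

Import GRing.Theory.
Local Open Scope ring_scope.

(* [all_field] also exports a constant named [gX]. *)
Local Notation gX := Defs.gX.

(** * Words and scalars in the unital free algebra *)

Section Words.
Variable I : choiceType.

Lemma FMonomM (s t : seq I) : mmul (FMonom s) (FMonom t) = FMonom (s ++ t).
Proof. by apply/eqP; rewrite fmP fmM. Qed.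

Lemma FMonom1 : mone = FMonom [::] :> {fmonom I}.
Proof. by apply/eqP; rewrite fmP fm1. Qed.

Lemma FMonom_eq1 (s : seq I) : (FMonom s == mone) = (s == [::]).
Proof. by rewrite FMonom1 fmP. Qed.

Variable R : comNzRingType.

(** The letters do not commute, but a constant sits on the empty word, which is neutral on both
    sides, and the coefficients commute. *)
Lemma malgC_comm (c : R) (f : {malg R[{fmonom I}]}) : GRing.comm c%:MP f.
Proof.
rewrite /GRing.comm !malgM_def fgmulgU fgmulUg.
by apply: eq_bigr => m _; rewrite mul1m mulm1 mulrC.
Qed.

Lemma malg_scalerAr (c : R) (f g : {malg R[{fmonom I}]}) :
  f * (c *: g) = c *: (f * g).
Proof. by rewrite -!mul_malgC !mulrA -(malgC_comm c f). Qed.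

Lemma malgUM (m n : {fmonom I}) :
  << m >> * << n >> = << mmul m n >> :> {malg R[{fmonom I}]}.
Proof. by rewrite malgM_def fgmulUU mulr1. Qed.

Lemma malgZU (c : R) (m : {fmonom I}) : c *: << m >> = << c *g m >>.
Proof. by rewrite -mul_malgC malgM_def fgmulUU mulr1 mul1m. Qed.

Lemma malg_sum (f : {malg R[{fmonom I}]}) :
  f = \sum_(m <- msupp f) f@_m *: << m >>.
Proof. by rewrite {1}[f]monalgE; apply: eq_bigr => m _; rewrite malgZU. Qed.

End Words.

(** * Evaluation of polynomials in an algebra *)

Section Evaluation.
Variables (F : fieldType) (G : zmodType) (A : algType F).
Variable rho : gvar G -> A.

Definition word_eval (m : gmon G) : A :=
  \prod_(x <- (m : seq (gvar G))) rho x.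

Lemma word_eval_is_mmorphism : mmorphism word_eval.
Proof.
split=> [m n|]; rewrite /word_eval; first by rewrite fmM big_cat.
by rewrite fm1 big_nil.
Qed.

HB.instance Definition _ :=
  isMultiplicative.Build (gmon G) A word_eval word_eval_is_mmorphism.

Lemma gevalE f : geval rho f = mmap (in_alg A) word_eval f.
Proof. by []. Qed.

Lemma gevalP (c : F) f h :
  geval rho (c *: f + h) = c *: geval rho f + geval rho h.
Proof. by rewrite !gevalE mmapD mmapZ /= mulr_algl. Qed.

Lemma geval_is_linear : linear (geval rho). Proof. exact: gevalP. Qed.

HB.instance Definition _ :=
  GRing.isLinear.Build F (ufree F G) A *:%R (geval rho) geval_is_linear.

(** [A] may be noncommutative: multiplicativity rests on the coefficients landing in the central
    scalars of [A], so that they commute with all word values. *)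
Lemma gevalM f h : geval rho (f * h) = geval rho f * geval rho h.
Proof.
have comm g (m n : gmon G) : GRing.comm (in_alg A g@_m) (word_eval n).
  by rewrite /GRing.comm /= mulr_algl mulr_algr.
by rewrite !gevalE; have [/= -> _] := commr_mmap_is_multiplicative comm.
Qed.

Lemma gevalU m : geval rho << m >> = word_eval m.
Proof. by rewrite gevalE mmapU /= scale1r mul1r. Qed.

Lemma geval_binomial (c : F) (s t : seq (gvar G)) :
  geval rho (<< FMonom s >> - c *: << FMonom t >>) =
  \prod_(x <- s) rho x - c *: \prod_(x <- t) rho x.
Proof. by rewrite linearB linearZ /= !gevalU. Qed.

End Evaluation.

(** * The nonunital free algebra, its renamings and its ideals *)

Section FreeAlgebra.
Variables (F : fieldType) (G : zmodType).
Implicit Types (f h u : ufree F G) (g : G) (s t : seq (gvar G)).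
Local Notation W s := (<< FMonom s >> : ufree F G).

Lemma malgWM s t : W s * W t = W (s ++ t).
Proof. by rewrite malgUM FMonomM. Qed.

Lemma gXE i g : gX F i g = W [:: (i.-1, g)].
Proof. by rewrite /gX fmuE. Qed.

Lemma gXM i g j (h : G) : gX F i g * gX F j h = W [:: (i.-1, g); (j.-1, h)].
Proof. by rewrite !gXE malgWM. Qed.

Lemma gXn i g n : gX F i g ^+ n = W (nseq n (i.-1, g)).
Proof.
elim: n => [|n IHn]; first by rewrite expr0 -FMonom1.
by rewrite exprS IHn gXE malgWM.
Qed.

Lemma in_freeU m : in_free (<< m >> : ufree F G) <-> m != mone.
Proof.
rewrite /in_free mcoeffU1; case: eqP => // _; split=> // /eqP.
by rewrite oner_eq0.
Qed.

Lemma in_free0 : in_free (0 : ufree F G). Proof. exact: mcoeff0. Qed.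

Lemma in_freeP (c : F) f h : in_free f -> in_free h -> in_free (c *: f + h).
Proof. by rewrite /in_free mcoeffD mcoeffZ => -> ->; rewrite mulr0 addr0. Qed.

Lemma in_freeB (c : F) f h : in_free f -> in_free h -> in_free (f - c *: h).
Proof. by rewrite /in_free mcoeffB mcoeffZ => -> ->; rewrite mulr0 subr0. Qed.

Lemma in_freeMl u f : in_free f -> in_free (f * u).
Proof.
rewrite /in_free => f0.
by have := rmorphM (@mcoeff (gmon G) F mone) f u => /= ->; rewrite f0 mul0r.
Qed.

Lemma in_free_msupp f m : in_free f -> m \in msupp f -> m != mone.
Proof.
by move=> f0; rewrite -mcoeff_neq0; apply: contraNneq => ->; apply/eqP.
Qed.

Lemma in_free_degU m : m != mone ->
  in_free_deg (mon_deg m) (<< m >> : ufree F G).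
Proof.
by move=> m0; split; [apply/in_freeU | move=> n; rewrite msuppU1 inE => /eqP->].
Qed.

Lemma in_free_deg0 g : in_free_deg g (0 : ufree F G).
Proof. by split; [exact: in_free0 | move=> m; rewrite msupp0 inE]. Qed.

Lemma in_free_degP g (c : F) f h :
  in_free_deg g f -> in_free_deg g h -> in_free_deg g (c *: f + h).
Proof.
move=> [f0 fg] [h0 hg]; split; first exact: in_freeP.
move=> m /(fsubsetP (msuppD_le _ _)); rewrite in_fsetU => /orP[|/hg //].
by move/(fsubsetP (msuppZ_le _ _)) => /fg.
Qed.

Section Substitution.
Variable tau : gvar G -> gvar G.
Hypothesis tau_deg : forall x, (tau x).2 = x.2.

Definition word_rename (m : gmon G) : ufree F G := W (map tau m).

Lemma word_rename_is_mmorphism : mmorphism word_rename.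
Proof.
split=> [m n|]; rewrite /word_rename; first by rewrite fmM map_cat malgWM.
by rewrite fm1 /= -FMonom1.
Qed.

HB.instance Definition _ := isMultiplicative.Build (gmon G) (ufree F G)
  word_rename word_rename_is_mmorphism.

Definition rename : ufree F G -> ufree F G := mmap malgC word_rename.

Lemma rename_linear (c : F) f h :
  rename (c *: f + h) = c *: rename f + rename h.
Proof. by rewrite /rename mmapD mmapZ /= mul_malgC. Qed.

Lemma renameM f h : rename (f * h) = rename f * rename h.
Proof.
have comm u (m n : gmon G) : GRing.comm (malgC u@_m) (word_rename n).
  exact: malgC_comm.
by rewrite /rename; have [/= -> _] := commr_mmap_is_multiplicative comm.
Qed.

Lemma rename_binomial (c : F) s t :
  rename (W s - c *: W t) = W (map tau s) - c *: W (map tau t).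
Proof. by rewrite /rename mmapB mmapZ /= mul_malgC !mmapU !mul1r. Qed.

Lemma renameE f : rename f = \sum_(m <- msupp f) f@_m *: W (map tau m).
Proof. by rewrite /rename mmapE; apply: eq_bigr => m _; rewrite mul_malgC. Qed.

Lemma rename_deg g f : in_free_deg g f -> in_free_deg g (rename f).
Proof.
move=> [f0 fg]; rewrite renameE big_seq.
elim/big_rec: _ => [|m h mf IH]; first exact: in_free_deg0.
apply: in_free_degP => //; rewrite -(fg _ mf).
have -> : mon_deg m = mon_deg (FMonom (map tau m)).
  by rewrite /mon_deg big_map; apply: eq_bigr => x _; rewrite tau_deg.
apply: in_free_degU; rewrite FMonom_eq1 -size_eq0 size_map size_eq0.
by rewrite -FMonom_eq1 fmK (in_free_msupp f0).
Qed.

Lemma rename_free f : in_free f -> in_free (rename f).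
Proof.
move=> f0; rewrite renameE big_seq.
elim/big_rec: _ => [|m h mf IH]; first exact: in_free0.
apply: in_freeP => //; apply/in_freeU.
rewrite FMonom_eq1 -size_eq0 size_map size_eq0.
by rewrite -FMonom_eq1 fmK (in_free_msupp f0).
Qed.

(** Degree-preserving renamings carry a relation between the fixed letters of a generator to
    arbitrary letters of the same degrees. *)
Lemma rename_endo : graded_endo rename.
Proof.
split=> [f|c f h _ _|f h _ _|g f]; [exact: rename_free|exact: rename_linear| |].
  exact: renameM.
exact: rename_deg.
Qed.

End Substitution.

Section Ideal.
Variable I : ufree F G -> Prop.
Hypothesis I_ideal : TG_ideal I.

Lemma in_free_split u : exists2 v, in_free v & u = u@_mone *: 1 + v.
Proof.
exists (u - u@_mone *: 1); last by rewrite addrC subrK.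
by rewrite /in_free mcoeffB mcoeffZ mcoeff1 eqxx mulr1 subrr.
Qed.

(** Splitting off the constant term of [u] leaves a scalar multiple of [f] plus a product with an
    element of the nonunital algebra. Contexts around a subword may therefore be empty. *)
Lemma TG_mull1 u f : I f -> I (u * f).
Proof.
move=> If; have [v v0 ->] := in_free_split u.
rewrite mulrDl -scalerAl mul1r.
by apply: (TG_lin I_ideal) => //; apply: (TG_mull I_ideal).
Qed.

Lemma TG_mulr1 u f : I f -> I (f * u).
Proof.
move=> If; have [v v0 ->] := in_free_split u.
rewrite mulrDr malg_scalerAr mulr1.
by apply: (TG_lin I_ideal) => //; apply: (TG_mulr I_ideal).
Qed.

End Ideal.
End FreeAlgebra.

(** * Graded identities form a T_G-ideal *)

Section IdentityIdeal.
Variables (F : fieldType) (G : zmodType) (A : algType F) (gr : G -> {pred A}).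
Hypothesis gr0 : forall g, 0 \in gr g.
Hypothesis gr_linear : forall g (c : F) a b,
  a \in gr g -> b \in gr g -> c *: a + b \in gr g.
Hypothesis grM : forall g h a b,
  a \in gr g -> b \in gr h -> a * b \in gr (g + h).
Local Notation W s := (<< FMonom s >> : ufree F G).

Lemma geval_deg (rho : gvar G -> A) g (f : ufree F G) :
  (forall x, rho x \in gr x.2) -> in_free_deg g f -> geval rho f \in gr g.
Proof.
move=> rho_gr [f0 fg]; rewrite [f]malg_sum linear_sum big_seq.
elim/big_rec: _ => // m a mf IH; rewrite linearZ /= gevalU.
apply: gr_linear => //; rewrite -(fg _ mf).
have: m != mone by exact: in_free_msupp f0 mf.
case: m {mf} => s; rewrite FMonom_eq1 /word_eval /mon_deg /=.
(* The induction starts at one-letter words, since [gr 0] is not assumed to contain 1. *)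
elim: s => // x s IHs _; rewrite !big_cons.
case: (eqVneq s [::]) => [->|s0]; first by rewrite !big_nil mulr1 addr0.
by apply: grM => //; apply: IHs.
Qed.

(** Evaluating after an endomorphism amounts to evaluating at another point, whose coordinates are
    the values of the images of the letters. This yields the invariance of identities under
    endomorphisms. *)
Lemma geval_endo (rho : gvar G -> A) phi (f : ufree F G) :
  graded_endo phi -> in_free f ->
  geval rho (phi f) = geval (fun x => geval rho (phi << fmu x >>)) f.
Proof.
move=> [_ phi_lin phiM _] f0; set rho' := fun x => _.
have phi0 : phi 0 = 0.
  have := phi_lin (-1) 0 0 (in_free0 F G) (in_free0 F G).
  by rewrite scaler0 addr0 scaleN1r addNr.
have word s : s != [::] -> geval rho (phi (W s)) = geval rho' (W s).
  elim: s => // x s IHs _; rewrite -cat1s -malgWM gevalM.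
  have -> : geval rho' (W [:: x]) = geval rho (phi (W [:: x])).
    by rewrite gevalU /word_eval big_seq1 /rho' fmuE.
  case: (eqVneq s [::]) => [->|s0].
    by rewrite malgWM cats0 gevalU /word_eval big_nil mulr1.
  by rewrite phiM ?gevalM ?IHs //; apply/in_freeU; rewrite FMonom_eq1.
rewrite [f]malg_sum big_seq.
(* Membership in the nonunital algebra is carried along the induction, because [phi] is linear only
   there. *)
suff [] : in_free (\sum_(m <- msupp f | m \in msupp f) f@_m *: << m >>) /\
  geval rho (phi (\sum_(m <- msupp f | m \in msupp f) f@_m *: << m >>)) =
  geval rho' (\sum_(m <- msupp f | m \in msupp f) f@_m *: << m >>) by [].
elim/big_rec: _ => [|m h mf [h0 IH]].
  by rewrite phi0 !linear0; split => //; apply: in_free0.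
have m0 := in_free_msupp f0 mf; have U0 := (in_freeU F m).2 m0.
split; first exact: in_freeP.
rewrite phi_lin // !gevalP IH -[m]fmK word //.
by rewrite -FMonom_eq1.
Qed.

Lemma identity_TG_ideal : TG_ideal (@graded_identity F G A gr).
Proof.
split.
- by move=> f [].
- by split=> [|rho _]; [exact: in_free0 | rewrite linear0].
- move=> c f h [f0 If] [h0 Ih]; split=> [|rho rho_gr]; first exact: in_freeP.
  by rewrite gevalP If // Ih // scaler0 addr0.
- move=> u f u0 [f0 If]; split=> [|rho rho_gr]; first exact: in_freeMl.
  by rewrite gevalM If // mulr0.
- move=> u f u0 [f0 If]; split=> [|rho rho_gr]; first exact: in_freeMl.
  by rewrite gevalM If // mul0r.
move=> phi phi_endo f [f0 If]; have [phi_free _ _ phi_deg] := phi_endo.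
split=> [|rho rho_gr]; first exact: phi_free.
rewrite geval_endo // If // => x; apply: geval_deg => //; apply: phi_deg.
have -> : x.2 = mon_deg (fmu x) by rewrite /mon_deg fmU big_seq1.
by apply: in_free_degU; rewrite fmuE FMonom_eq1.
Qed.

End IdentityIdeal.

(** * Reduction of words to ordered words *)

Section NormalForm.
Variables (F : fieldType) (G : zmodType) (I : ufree F G -> Prop) (q : nat).
Local Notation W s := (<< FMonom s >> : ufree F G).
Hypothesis I_ideal : TG_ideal I.
Hypothesis q_gt1 : (1 < q)%N.

(** Spanning does not depend on the constants, so the signs and values of [beta] collected during a
    reduction are hidden under an existential. *)
Variant proportional (s t : seq (gvar G)) : Prop :=
  Proportional c of I (W s - c *: W t).

Hypothesis I_swap : forall x y, proportional [:: x; y] [:: y; x].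
Hypothesis I_pow : forall x, proportional (nseq q x) [:: x].

Lemma proportional_refl s : proportional s s.
Proof. by exists 1; rewrite scale1r subrr; apply: TG_0. Qed.

Lemma proportional_trans s t u :
  proportional s t -> proportional t u -> proportional s u.
Proof.
move=> [c Ic] [d Id]; exists (c * d).
have -> : W s - (c * d) *: W u = c *: (W t - d *: W u) + (W s - c *: W t).
  by rewrite scalerBr scalerA [RHS]addrC addrA subrK.
exact: (TG_lin I_ideal).
Qed.

Lemma proportional_catl u s t :
  proportional s t -> proportional (u ++ s) (u ++ t).
Proof.
move=> [c Ic]; exists c.
by have := TG_mull1 I_ideal (W u) Ic; rewrite mulrBr malg_scalerAr !malgWM.
Qed.

Lemma proportional_catr u s t :
  proportional s t -> proportional (s ++ u) (t ++ u).
Proof.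
move=> [c Ic]; exists c.
by have := TG_mulr1 I_ideal (W u) Ic; rewrite mulrBl -scalerAl !malgWM.
Qed.

Lemma proportional_perm s t : perm_eq s t -> proportional s t.
Proof.
elim: s t => [|x s IHs] t.
  by rewrite perm_sym => /perm_nilP->; apply: proportional_refl.
move=> st; have xt : x \in t by rewrite -(perm_mem st) mem_head.
case/splitPr: xt st => t1 t2 st.
have {}st : perm_eq s (t1 ++ t2).
  by rewrite -(perm_cons x) (permPl st) -(cat1s x t2) perm_catCA.
(* First the tail is permuted behind the head [x]; then [x] moves right across [t1], one adjacent
   swap at a time. *)
apply: proportional_trans (proportional_catl [:: x] (IHs _ st)) _.
elim: t1 {st} => [|y t1 IHt] /=; first exact: proportional_refl.
apply: proportional_trans (proportional_catr (t1 ++ t2) (I_swap x y)) _.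
exact (proportional_catl [:: y] IHt).
Qed.

(** Strong induction on length: either sorting suffices, or q equal letters are gathered in front
    and replaced by one, which shortens the word because q > 1. *)
Lemma normal_word (le : rel (gvar G)) s : total le -> s != [::] ->
  exists2 m, m \in ordered_mon le q & proportional s (m : gmon G).
Proof.
move=> le_total; have [n] := ubnP (size s); elim: n s => // n IHn s.
rewrite ltnS => sn s0.
have sort_s : perm_eq s (sort le s) by rewrite perm_sym perm_sort.
case: (boolP (all (fun x => count_mem x s < q)%N s)) => [s_small|].
  exists (FMonom (sort le s)); last exact: proportional_perm.
  rewrite inE FMonom_eq1 -size_eq0 size_sort size_eq0 s0 sort_sorted //=.
  rewrite all_sort; apply: sub_all s_small => x.
  by rewrite (permP sort_s).
case/allPn => x xs; rewrite -leqNgt => qx.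
(* What remains of [s] after removing q copies of [x]: the surplus copies and all other letters. *)
pose u := nseq (count_mem x s - q) x ++ [seq y <- s | y != x].
have s_perm : perm_eq s (nseq q x ++ u).
  rewrite catA cat_nseq.
  have -> : ncons q x (nseq (count_mem x s - q) x) = nseq (count_mem x s) x.
    by rewrite -cat_nseq -nseqD subnKC.
  rewrite -(perm_filterC (pred1 x)) perm_sym.
  have -> : nseq (count_mem x s) x = [seq y <- s | pred1 x y].
    rewrite -size_filter; apply/esym/all_pred1P; exact: filter_all.
  exact: perm_refl.
have s_u : proportional s (x :: u).
  apply: proportional_trans (proportional_perm s_perm) _.
  exact (proportional_catr u (I_pow x)).
have [|//|m m_ord m_u] := IHn (x :: u).
  apply: leq_trans sn; rewrite (perm_size s_perm) size_cat size_nseq /=.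
  by rewrite -[(size u).+1]add1n ltn_add2r.
by exists m => //; apply: proportional_trans m_u.
Qed.

Lemma normal_form (le : rel (gvar G)) f : total le -> in_free f ->
  exists2 h : ufree F G, {subset msupp h <= ordered_mon le q} & I (f - h).
Proof.
move=> le_total f0; rewrite [f]malg_sum big_seq.
elim/big_rec: _ => [|m g mf [h h_ord Ih]].
  by exists 0 => [m|]; [rewrite msupp0 inE | rewrite subrr; apply: TG_0].
have [||n n_ord [c Ic]] := @normal_word le m => //.
  by rewrite -FMonom_eq1 fmK (in_free_msupp f0).
exists (f@_m *: (c *: << n >>) + h).
  move=> k /(fsubsetP (msuppD_le _ _)); rewrite in_fsetU => /orP[|/h_ord //].
  move/(fsubsetP (msuppZ_le _ _)) /(fsubsetP (msuppZ_le _ _)).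
  by rewrite msuppU1 inE => /eqP->.
rewrite opprD addrACA -scalerBr.
by rewrite !fmK in Ic; apply: (TG_lin I_ideal) Ic Ih.
Qed.

End NormalForm.

(** * Reduced polynomials over a finite field *)

Section ReducedPolynomials.
Variable F : finFieldType.

(** The Vandermonde matrix on all elements of [F] is invertible since they are distinct; the weights
    are the entries of its inverse. *)
Lemma dual_power : exists lam : nat -> F -> F, forall k e,
  (k < #|F|)%N -> (e < #|F|)%N -> \sum_a lam k a * a ^+ e = (k == e)%:R.
Proof.
pose M := Vandermonde #|F| (\row_(j < #|F|) (enum_val j : F)).
have M_unit : M \in unitmx.
  rewrite unitmxE det_Vandermonde unitfE; apply/prodf_neq0 => i _.
  apply/prodf_neq0 => j ij; rewrite !mxE subr_eq0.
  by apply: contraTneq ij => /enum_val_inj->; rewrite ltnn.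
(* The default 0 concerns only k >= q, outside the range of the claim. *)
pose lam (k : nat) (a : F) :=
  if insub k is Some i then invmx M (enum_rank a) i else 0.
exists lam => k e kq eq; have := mulmxV M_unit.
move/matrixP => /(_ (Ordinal eq) (Ordinal kq)); rewrite !mxE /= eq_sym => <-.
rewrite /lam insubT (reindex (@enum_val F predT)) /=; last first.
  exact: (onW_bij _ (enum_val_bij _)).
by apply: eq_bigr => i _; rewrite enum_valK !mxE mulrC.
Qed.

(* The weights dual to the powers, multiplied over the variables, extract each
   coefficient from the values of the polynomial. *)
Lemma reduced_vanish (V : lmodType F) (T : finType) (J : eqType) (s : seq J)
    (e : J -> T -> nat) (v : J -> V) :
  uniq s -> {in s &, forall i j, e i =1 e j -> i = j} ->
  {in s, forall j t, (e j t < #|F|)%N} ->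
  (forall a : T -> F, \sum_(j <- s) (\prod_t a t ^+ e j t) *: v j = 0) ->
  {in s, forall j, v j = 0}.
Proof.
move=> s_uniq e_inj e_small zero k ks; have [lam lamP] := dual_power.
have : \sum_(a : {ffun T -> F}) (\prod_t lam (e k t) (a t)) *:
    (\sum_(j <- s) (\prod_t a t ^+ e j t) *: v j) = 0.
  by apply: big1 => a _; rewrite zero scaler0.
under eq_bigr do rewrite scaler_sumr.
have extract j : \sum_(a : {ffun T -> F}) (\prod_t lam (e k t) (a t)) *:
    ((\prod_t a t ^+ e j t) *: v j) =
    (\prod_t \sum_b lam (e k t) b * b ^+ e j t) *: v j.
  rewrite bigA_distr_bigA scaler_suml; apply: eq_bigr => a _.
  by rewrite scalerA big_split.
rewrite exchange_big (bigD1_seq k) //= extract.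
rewrite [X in _ + X]big1_seq => [|j /andP[jk js]].
  by rewrite addr0 big1 ?scale1r // => t _; rewrite lamP ?eqxx ?e_small.
(* Distinct exponent vectors differ at some variable [t], and the weights dual to the powers make
   the factor at [t] vanish. *)
rewrite extract; have [t ekj] : exists t, e k t != e j t.
  apply/existsP; apply: contra_neqT jk => /existsPn ekj.
  by apply: e_inj => // t; apply/esym/eqP; rewrite -[_ == _]negbK ekj.
by rewrite (bigD1 t) //= lamP ?e_small // (negPf ekj) mul0r scale0r.
Qed.

End ReducedPolynomials.

(** * Linear independence of ordered words modulo identities *)

Lemma prod_count (R : comNzRingType) (I : choiceType) (ws s : seq I)
    (a : seq_sub ws -> R) :
  {subset s <= ws} ->
  \prod_(x <- s) (if insub x is Some t then a t else 0) =
  \prod_t a t ^+ count_mem (ssval t) s.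
Proof.
elim: s => [|x s IHs] s_ws; first by rewrite big_nil big1.
have xws : x \in ws by rewrite s_ws ?mem_head.
rewrite big_cons insubT IHs => [|y ys]; last by rewrite s_ws // inE ys orbT.
rewrite (bigD1 (SeqSub xws)) //= mulrA -exprS.
rewrite [RHS](bigD1 (SeqSub xws)) //= eqxx; congr (_ * _).
apply: eq_bigr => t tx; suff /negPf-> : x != ssval t by [].
by apply: contraNneq tx => xt; apply/eqP/val_inj.
Qed.

Lemma word_evalZ (F : fieldType) (G : zmodType) (A : algType F)
    (a : gvar G -> F) (rho : gvar G -> A) m :
  word_eval (fun x => a x *: rho x) m =
  (\prod_(x <- (m : seq (gvar G))) a x) *: word_eval rho m.
Proof. by rewrite /word_eval scaler_prod. Qed.

Lemma ordered_identity_eq0 (F : finFieldType) (G : zmodType) (A : unitAlgType F)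
    (gr : G -> {pred A}) (P : G -> A) (le : rel (gvar G)) (s : seq (gmon G))
    (c : gmon G -> F) :
  (forall g (a : F), a *: P g \in gr g) -> (forall g, P g \is a GRing.unit) ->
  total le -> antisymmetric le -> transitive le ->
  uniq s -> {subset s <= ordered_mon le #|F|} ->
  graded_identity gr (\sum_(m <- s) c m *: (<< m >> : ufree F G)) ->
  {in s, forall m, c m = 0}.
Proof.
move=> gr_P P_unit le_total le_anti le_trans s_uniq s_ord [_ Id] m ms.
(* Only the letters occurring in the combination matter; they form the finite index type
   [seq_sub ws] that [reduced_vanish] asks for. *)
pose ws := flatten [seq (n : seq (gvar G)) | n : gmon G <- s].
pose rho (x : gvar G) := P x.2.
pose e (n : gmon G) (t : seq_sub ws) := count_mem (ssval t) n.
have sub_ws (n : gmon G) : n \in s -> {subset (n : seq (gvar G)) <= ws}.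
  move=> ns x xn; apply/flattenP; exists (n : seq (gvar G)) => //.
  exact: map_f.
have count_inj : {in s &, forall n1 n2, e n1 =1 e n2 -> n1 = n2}.
  move=> n1 n2 n1s n2s e12; apply/eqP; rewrite fmP; apply/eqP.
  have /and3P[_ n1_sorted _] := s_ord _ n1s.
  have /and3P[_ n2_sorted _] := s_ord _ n2s.
  (* Sorted permutations of each other coincide, and counts need comparing only at letters of the
     two words, all of which lie in [ws]. *)
  apply: (sorted_eq le_trans le_anti) => //; apply/allP => x.
  rewrite mem_cat => x12; have xws : x \in ws.
    by case/orP: x12 => [/(sub_ws n1 n1s)|/(sub_ws n2 n2s)].
  exact/eqP/(e12 (SeqSub xws)).
have e_small : {in s, forall n t, (e n t < #|F|)%N}.
  move=> n ns t; have /and3P[_ _ /allP n_small] := s_ord _ ns.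
  have [/n_small //|tn] := boolP (ssval t \in (n : seq (gvar G))).
  by rewrite /e (count_memPn tn); apply/card_gt0P; exists 0.
have zero (a : seq_sub ws -> F) :
    \sum_(n <- s) (\prod_t a t ^+ e n t) *: (c n *: word_eval rho n) = 0.
  (* Letters outside [ws] get the scalar 0, harmlessly: no word of [s] contains one. *)
  pose b x := if insub x is Some t then a t else 0.
  have := Id (fun x => b x *: rho x) (fun x => gr_P _ _).
  rewrite linear_sum => zero; rewrite -[RHS]zero !big_seq.
  apply: eq_bigr => n ns; rewrite [RHS]linearZ /= gevalU word_evalZ.
  by rewrite /b prod_count ?scalerA ?[_ * c n]mulrC //; apply: sub_ws.
have /eqP := reduced_vanish s_uniq count_inj e_small zero ms.
rewrite scaler_eq0 => /orP[/eqP //|/eqP n0].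
have : word_eval rho m \is a GRing.unit.
  rewrite /word_eval; elim/big_ind: _ => [|x y xu yu|x _]; last exact: P_unit.
    exact: unitr1.
  by rewrite unitrMl.
by rewrite n0 unitr0.
Qed.

(** The intersection of all T_G-ideals containing [S] inherits every closure property; [I0] shows
    that the family is nonempty, so that the intersection lies in the nonunital algebra. *)
Lemma TG_generated_ideal (F : fieldType) (G : zmodType)
    (S I0 : ufree F G -> Prop) :
  TG_ideal I0 -> (forall f, S f -> I0 f) -> TG_ideal (TG_generated S).
Proof.
move=> I0_ideal S_I0; split.
- by move=> f If; apply: (TG_free I0_ideal); apply: If.
- by move=> I I_ideal _; exact: (TG_0 I_ideal).
- move=> c f h If Ih I I_ideal SI.
  by apply: (TG_lin I_ideal); [exact: (If I) | exact: (Ih I)].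
- move=> u f u0 If I I_ideal SI.
  by apply: (TG_mull I_ideal) => //; exact: (If I).
- move=> u f u0 If I I_ideal SI.
  by apply: (TG_mulr I_ideal) => //; exact: (If I).
move=> phi phiE f If I I_ideal SI.
by apply: (TG_endo I_ideal) => //; exact: (If I).
Qed.

(** * The Pauli grading and its generating identities *)

Section PauliIdentities.
Variables (F : finFieldType) (X Y : 'M[F]_2) (beta : Z22 -> Z22 -> F).
Hypothesis char_neq2 : 2%N \notin [pchar F].
Hypotheses (X_unit : X \in unitmx) (Y_unit : Y \in unitmx).
Hypotheses (X2_scalar : is_scalar_mx (X * X)) (Y2_scalar : is_scalar_mx (Y * Y)).
Hypothesis XY_anticomm : X * Y = - (Y * X).
Hypothesis beta_alt : alternating_bicharacter beta.
Hypothesis beta_ab : beta (1, 0) (0, 1) = -1.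
Local Notation P := (pauli X Y).
Local Notation Id := (@graded_identity F Z22 'M[F]_2 (pauli_gr X Y)).

Lemma pauli_unit g : P g \is a GRing.unit.
Proof. by rewrite /pauli unitrMl unitrX. Qed.

Lemma pauli_grE g A : (A \in pauli_gr X Y g) = (A \in <[P g]>%VS).
Proof. by []. Qed.

Lemma mem_pauli_gr g (c : F) : c *: P g \in pauli_gr X Y g.
Proof. by rewrite pauli_grE memvZ ?memv_line. Qed.

Lemma Z2_cases (i : 'Z_2) : i = 0 \/ i = 1.
Proof. by case: i => [[|[|//]] ?]; [left|right]; apply: val_inj. Qed.

(** Commutation factors multiply when either argument is a product, as the bicharacter [beta] does.
    Hence only the degrees (i,0) and (0,j), that is powers of [X] and of [Y], need checking. *)
Lemma pauli_comm g h : P g * P h = beta g h *: (P h * P g).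
Proof.
have b0l k : beta 0 k = 1.
  apply: (mulfI (bichar_neq0 beta_alt 0 k)).
  by rewrite -(bichar_Dl beta_alt) addr0 mulr1.
have b0r k : beta k 0 = 1.
  apply: (mulfI (bichar_neq0 beta_alt k 0)).
  by rewrite -(bichar_Dr beta_alt) addr0 mulr1.
(* Expanding [beta] at (1,1), (1,1), where it equals 1, leaves the product of the two mixed
   values. *)
have ba : beta (0, 1) (1, 0) = -1.
  have := bichar_alt beta_alt ((1, 0) + (0, 1)).
  rewrite (bichar_Dl beta_alt) !(bichar_Dr beta_alt) !(bichar_alt beta_alt).
  by rewrite beta_ab mul1r mulr1 mulN1r => <-; rewrite opprK.
have split2 (i j : 'Z_2) : (i, j) = (i, 0) + (0, j) :> Z22.
  by congr pair; rewrite ?addr0 ?add0r.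
have P2 (i j : 'Z_2) : P (i, j) = P (i, 0) * P (0, j).
  by rewrite /pauli /= !expr0 mulr1 mul1r.
have combl A B C (a b : F) : A * C = a *: (C * A) -> B * C = b *: (C * B) ->
    (A * B) * C = (a * b) *: (C * (A * B)) :> 'M[F]_2.
  move=> hA hB; rewrite -mulrA hB -scalerAr.
  rewrite [A * (C * B)]mulrA hA -scalerAl scalerA mulrA.
  by rewrite [b * a]mulrC.
have combr A B C (a b : F) : C * A = a *: (A * C) -> C * B = b *: (B * C) ->
    C * (A * B) = (a * b) *: ((A * B) * C) :> 'M[F]_2.
  move=> hA hB; rewrite mulrA hA -scalerAl.
  by rewrite -[A * C * B]mulrA hB -scalerAr scalerA !mulrA.
case: g h => [i j] [k l].
rewrite (P2 i j) (P2 k l) (split2 i j) (split2 k l).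
rewrite (bichar_Dl beta_alt) !(bichar_Dr beta_alt).
have P0 : P 0 = 1 by rewrite /pauli /= !expr0 mulr1.
have PX : P (1, 0) = X by rewrite /pauli /= expr0 mulr1 expr1.
have PY : P (0, 1) = Y by rewrite /pauli /= expr0 mul1r expr1.
apply: combl; apply: combr.
- case: (Z2_cases i) (Z2_cases k) => -> [] ->;
  by rewrite ?P0 ?b0l ?b0r ?mul1r ?mulr1 ?scale1r //
    (bichar_alt beta_alt) scale1r.
- case: (Z2_cases i) (Z2_cases l) => -> [] ->;
  by rewrite ?P0 ?b0l ?b0r ?mul1r ?mulr1 ?scale1r // beta_ab PX PY scaleN1r.
- case: (Z2_cases j) (Z2_cases k) => -> [] ->;
  rewrite ?P0 ?b0l ?b0r ?mul1r ?mulr1 ?scale1r // ba PX PY scaleN1r XY_anticomm.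
  by rewrite opprK.
case: (Z2_cases j) (Z2_cases l) => -> [] ->;
by rewrite ?P0 ?b0l ?b0r ?mul1r ?mulr1 ?scale1r //
    (bichar_alt beta_alt) scale1r.
Qed.

(** Since q is odd, P^q is P times the (q-1)/2-th power of the scalar P^2. *)
Lemma pauli_pow g : P g ^+ #|F| = pauli_sgn X Y g *: P g.
Proof.
have [w [_ PP ->]] := pauli_sgnP char_neq2 X_unit Y_unit X2_scalar Y2_scalar
  XY_anticomm (memv_line (P g)) (pauli_neq0 X_unit Y_unit g).
have q_gt0 : (0 < #|F|)%N by apply/card_gt0P; exists 0.
(* If q were even, (-1)^q would be 1, while every element of [F] equals its q-th power; so 1 =
   -1. *)
have q_odd : odd #|F|.
  apply: contraNT char_neq2 => q_even; rewrite inE /=.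
  have := expf_card (-1 : F).
  by rewrite -signr_odd (negPf q_even) expr0 => /eqP; rewrite -addr_eq0.
rewrite -{1}(odd_double_half #|F|) q_odd add1n exprS -mul2n exprM expr2 PP.
have -> : #|F|./2 = (#|F|.-1)./2.
  by case: #|F| q_odd => //= n; rewrite uphalf_half => /negPf->.
by rewrite -[w%:M]scalemx1 exprZn expr1n -scalerAr mulr1.
Qed.

Lemma pauli_identity_ideal : TG_ideal Id.
Proof.
have [_ _ grM] :=
  pauli_grading char_neq2 X_unit Y_unit X2_scalar Y2_scalar XY_anticomm.
apply: identity_TG_ideal => [g|g c a b|g h a b]; rewrite !pauli_grE.
- exact: mem0v.
- by move=> ag bg; rewrite memvD ?memvZ.
by move=> ag bh; apply: (subvP (grM g h)); apply: memv_mul.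
Qed.

(** Homogeneous elements are scalar multiples of Pauli matrices: c^q = c in [F] settles the power
    relation, bilinearity the commutation relation. *)
Lemma pauli_gens_identity f : pauli_gens X Y beta f -> Id f.
Proof.
case=> [[g ->]|[g [h ->]]]; split.
- rewrite gXn gXE; apply: in_freeB; apply/in_freeU; rewrite FMonom_eq1 //.
  by rewrite -size_eq0 size_nseq -lt0n; apply/card_gt0P; exists 0.
- move=> rho rho_gr; have /vlineP[c rhoE] := rho_gr (0%N, g).
  rewrite gXn gXE geval_binomial big_seq1 big_nseq.
  by rewrite iter_mulr_1 rhoE exprZn expf_card pauli_pow !scalerA mulrC subrr.
- by rewrite 2!gXM; apply: in_freeB; apply/in_freeU; rewrite FMonom_eq1.
move=> rho rho_gr; have /vlineP[c cE] := rho_gr (0%N, g).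
have /vlineP[d dE] := rho_gr (1%N, h).
rewrite 2!gXM geval_binomial !big_cons !big_nil cE dE /=.
rewrite !mulr1 -!scalerAl -!scalerAr pauli_comm !scalerA.
by rewrite [c * d]mulrC -[beta g h * d * c]mulrA [beta g h * _]mulrC subrr.
Qed.

Lemma generated_swap (I : ufree F Z22 -> Prop) : TG_ideal I ->
  (forall f, pauli_gens X Y beta f -> I f) ->
  forall x y, proportional I [:: x; y] [:: y; x].
Proof.
move=> I_ideal gens_I x y.
(* The letters with indices 1 and 2 are stored with indices 0 and 1. Testing the index and not the
   degree keeps them apart even when [x] and [y] have equal degrees. *)
pose tau (z : gvar Z22) : gvar Z22 := (if z.1 == 0%N then x.1 else y.1, z.2).
have tau_deg z : (tau z).2 = z.2 by [].
have := TG_endo I_ideal (rename_endo F tau_deg)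
  (gens_I _ (or_intror (ex_intro _ x.2 (ex_intro _ y.2 erefl)))).
rewrite 2!gXM rename_binomial /= /tau /=.
by rewrite -!surjective_pairing; exists (beta x.2 y.2).
Qed.

Lemma generated_pow (I : ufree F Z22 -> Prop) : TG_ideal I ->
  (forall f, pauli_gens X Y beta f -> I f) ->
  forall x, proportional I (nseq #|F| x) [:: x].
Proof.
move=> I_ideal gens_I x.
pose tau (z : gvar Z22) : gvar Z22 := (x.1, z.2).
have tau_deg z : (tau z).2 = z.2 by [].
have := TG_endo I_ideal (rename_endo F tau_deg)
  (gens_I _ (or_introl (ex_intro _ x.2 erefl))).
rewrite gXn gXE rename_binomial map_nseq /= /tau /=.
by rewrite -!surjective_pairing; exists (pauli_sgn X Y x.2).
Qed.

(** Leaving the ideal arbitrary serves both claims: spanning uses the identities themselves,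
    generation uses the ideal spanned by the generators. *)
Lemma pauli_identity_normal (I : ufree F Z22 -> Prop) (le : rel (gvar Z22)) f :
  TG_ideal I -> (forall f, pauli_gens X Y beta f -> I f) -> total le ->
  in_free f ->
  exists2 h : ufree F Z22, {subset msupp h <= ordered_mon le #|F|} & I (f - h).
Proof.
move=> I_ideal gens_I; apply: (normal_form I_ideal (finNzRing_gt1 F)).
  exact: generated_swap.
exact: generated_pow.
Qed.

Lemma pauli_ordered_identity (le : rel (gvar Z22)) (s : seq (gmon Z22)) c :
  total le -> antisymmetric le -> transitive le ->
  uniq s -> {subset s <= ordered_mon le #|F|} ->
  Id (\sum_(m <- s) c m *: (<< m >> : ufree F Z22)) ->
  {in s, forall m, c m = 0}.
Proof. exact: ordered_identity_eq0 mem_pauli_gr pauli_unit. Qed.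

End PauliIdentities.

Theorem theorem30 (F : finFieldType) (char_neq2 : 2%N \notin [pchar F])
    (X Y : 'M[F]_2)
    (X_unit : X \in unitmx) (Y_unit : Y \in unitmx)
    (X2_scalar : is_scalar_mx (X * X)) (Y2_scalar : is_scalar_mx (Y * Y))
    (XY_anticomm : X * Y = - (Y * X))
    (beta : Z22 -> Z22 -> F)
    (beta_alt : alternating_bicharacter beta)
    (beta_ab : beta (1, 0) (0, 1) = -1) :
  (forall f : ufree F Z22,
     graded_identity (pauli_gr X Y) f <-> TG_generated (pauli_gens X Y beta) f)
  /\
  (forall le : rel (gvar Z22),
     total le -> antisymmetric le -> transitive le ->
     quotient_basis (@in_free F Z22) (graded_identity (pauli_gr X Y))
       (ordered_mon le #|F|) (fun m : gmon Z22 => (<< m >> : ufree F Z22))).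
Proof.
have Id_ideal : TG_ideal (graded_identity (pauli_gr X Y)).
  exact: pauli_identity_ideal.
have gens_Id f : pauli_gens X Y beta f -> graded_identity (pauli_gr X Y) f.
  exact: pauli_gens_identity.
split=> [f|le le_total le_anti le_trans]; last first.
  split=> [m /and3P[m0 _ _]|f f0|s c s_uniq s_ord].
  - exact/in_freeU.
  - have [h h_ord Ih] := pauli_identity_normal Id_ideal gens_Id le_total f0.
    by exists (msupp h), (fun m => h@_m); rewrite -malg_sum.
  exact: pauli_ordered_identity.
split=> [Id_f|]; last by apply.
(* Generation mentions no order, so any total order on the letters will do; this one compares their
   codes as natural numbers. *)
pose le (x y : gvar Z22) := (choice.pickle x <= choice.pickle y)%N.
have le_total : total le by move=> x y; apply: leq_total.
have le_anti : antisymmetric le.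
  by move=> x y /anti_leq xy; apply: (pcan_inj choice.pickleK).
have le_trans : transitive le by move=> x y z; apply: leq_trans.
have J_ideal := TG_generated_ideal Id_ideal gens_Id.
have gens_J h : pauli_gens X Y beta h -> TG_generated (pauli_gens X Y beta) h.
  by move=> Sh I _; apply.
(* Modulo the generated ideal, [f] becomes a combination [h] of ordered words. Since that ideal
   consists of identities, [h] is an identity too, and independence forces h = 0. *)
have [h h_ord Jh] := pauli_identity_normal J_ideal gens_J le_total Id_f.1.
suff h0 : h = 0 by move: Jh; rewrite h0 subr0.
have Id_h : graded_identity (pauli_gr X Y) h.
  have := TG_lin Id_ideal (-1) (Jh _ Id_ideal gens_Id) Id_f.
  by rewrite scaleN1r opprB subrK.
rewrite [h]malg_sum big_seq big1 // => m mh.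
move: Id_h; rewrite {1}[h]malg_sum => Id_h.
have h_uniq : uniq (msupp h) by exact: fset_uniq.
have hm := pauli_ordered_identity X_unit Y_unit le_total le_anti le_trans
  h_uniq h_ord Id_h mh.
by rewrite hm scale0r.
Qed.
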